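(* Let $\eta_0>0$, $\xi>0$, $0<k_c<\infty$, $\eta_1>-2$. The variance $G(0)$ of the three-dimensional FGC-SSRF with parameters $(\eta_0,\eta_1,\xi,k_c)$ is $$G(0)=\frac{\eta_0}{4\pi^2}\,V_3(\eta_1,k_c\xi),$$ where $$V_3(\eta_1,x)=\begin{cases}\dfrac{1}{4\beta_1}\ln\!\left(\dfrac{x^2-2\beta_1x+1}{x^2+2\beta_1x+1}\right)+\dfrac{1}{2\beta_2}\displaystyle\sum_{l=\pm1}\tan^{-1}\!\left(\dfrac{x+l\beta_1}{\beta_2}\right), & |\eta_1|<2,\\[3mm] \tan^{-1}(x)-\dfrac{x}{1+x^2}, & \eta_1=2,\\[3mm] \dfrac{2}{\Delta}\displaystyle\sum_{l=1,2}(-1)^{l}\,\omega_l\,\tan^{-1}\!\left(\dfrac{x}{\omega_l}\right), & \eta_1>2.\end{cases}$$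
   Context: The three-dimensional FGC-SSRF with parameters $(\eta_0,\eta_1,\xi,k_c)$ is the stationary, isotropic, zero-mean Gaussian random field on $\mathbb{R}^3$ with covariance function $$G(\mathbf{r})=\frac{1}{(2\pi)^3}\int_{|\mathbf{k}|\le k_c}e^{i\mathbf{k}\cdot\mathbf{r}}\,\frac{\eta_0\,\xi^3}{1+\eta_1(|\mathbf{k}|\xi)^2+(|\mathbf{k}|\xi)^4}\,d\mathbf{k},\qquad \mathbf{r}\in\mathbb{R}^3.$$ Notation: $\Delta=|\eta_1^2-4|^{1/2}$; $\beta_1=\frac{|2-\eta_1|^{1/2}}{2}$, $\beta_2=\frac{|2+\eta_1|^{1/2}}{2}$; $\omega_1=\left(\frac{|\eta_1-\Delta|}{2}\right)^{1/2}$, $\omega_2=\left(\frac{|\eta_1+\Delta|}{2}\right)^{1/2}$. *)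

(* Defs.v *)
From HB Require Import structures.
From mathcomp Require Import all_boot all_order all_algebra.
From mathcomp Require Import complex.
From mathcomp Require Import all_classical all_reals all_analysis.

Set Implicit Arguments.
Unset Strict Implicit.
Unset Printing Implicit Defensive.

Import Order.TTheory GRing.Theory Num.Theory.
Import numFieldNormedType.Exports.

Local Open Scope classical_set_scope.
Local Open Scope ring_scope.
Local Open Scope complex_scope.

(** Three-dimensional space: the library has Lebesgue measure on [R] and binary
    products of measures, so R^3 is [R * R * R]; its additive group structure is
    the one of product types. *)
Definition dot3 (R : realType) (k r : R * R * R) : R :=
  k.1.1 * r.1.1 + k.1.2 * r.1.2 + k.2 * r.2.

(** The Euclidean norm; the library norm on products is the sup norm. *)
Definition norm3 (R : realType) (k : R * R * R) : R := Num.sqrt (dot3 k k).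

Definition lebesgue3 (R : realType) :=
  ((@lebesgue_measure R \x @lebesgue_measure R) \x @lebesgue_measure R)%E.

Definition expi (R : realType) (theta : R) : R[i] := cos theta +i* sin theta.

Definition cintegral d (T : measurableType d) (R : realType)
    (mu : {measure set T -> \bar R}) (D : set T) (f : T -> R[i]) : R[i] :=
  (\int[mu]_(x in D) complex.Re (f x)) +i* (\int[mu]_(x in D) complex.Im (f x)).

Definition fgc_spectral_density (R : realType) (eta0 eta1 xi kappa : R) : R :=
  eta0 * xi ^+ 3 / (1 + eta1 * (kappa * xi) ^+ 2 + (kappa * xi) ^+ 4).

Definition fgc_covariance (R : realType) (eta0 eta1 xi kc : R)
    (r : R * R * R) : R[i] :=
  (((2 * pi) ^+ 3)^-1)%:C *
  cintegral (@lebesgue3 R) [set k | norm3 k <= kc]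
    (fun k => expi (dot3 k r) * (fgc_spectral_density eta0 eta1 xi (norm3 k))%:C).

(** Normal laws, including the degenerate ones. The library's [normal_prob m s]
    is the uniform law on [0, 1] for [s = 0], hence the separate Dirac case. *)
Definition has_gaussian_law d (T : measurableType d) (R : realType)
    (P : probability T R) (Y : T -> R) : Prop :=
  (exists m s : R, s != 0 /\
     forall A : set R, measurable A -> pushforward P Y A = normal_prob m s A) \/
  (exists m : R,
     forall A : set R, measurable A -> pushforward P Y A = (\d_m A)%E).

Section random_field.
Context d (T : measurableType d) (R : realType) (P : probability T R).
Variable X : R * R * R -> {RV P >-> R}.
Local Open Scope ereal_scope.

Definition gaussian_field : Prop :=
  forall (n : nat) (t : 'I_n -> R * R * R) (a : 'I_n -> R),
    has_gaussian_law P (fun w => \sum_(i < n) a i * X (t i) w)%R.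

Definition centered_field : Prop := forall s, 'E_P[X s] = 0.

Definition stationary_field : Prop :=
  (forall s t, 'E_P[X s] = 'E_P[X t]) /\
  (forall s t h,
     covariance P (X (s + h)%R) (X (t + h)%R) = covariance P (X s) (X t)).

Definition isotropic_field : Prop :=
  forall s t s' t', norm3 (s - t)%R = norm3 (s' - t')%R ->
    covariance P (X s) (X t) = covariance P (X s') (X t').

(** The covariance is extended-real valued and [G] is complex valued; both have
    to be the same real number. *)
Definition has_covariance_function (G : R * R * R -> R[i]) : Prop :=
  forall s t, exists2 c : R, covariance P (X s) (X t) = c%:E & c%:C = G (s - t)%R.

End random_field.

Record is_fgc_ssrf d (T : measurableType d) (R : realType) (P : probability T R)
    (eta0 eta1 xi kc : R) (X : R * R * R -> {RV P >-> R}) : Prop := {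
  fgc_stationary : stationary_field X ;
  fgc_isotropic : isotropic_field X ;
  fgc_centered : centered_field X ;
  fgc_gaussian : gaussian_field X ;
  fgc_has_covariance :
    has_covariance_function X (fgc_covariance eta0 eta1 xi kc) }.

Definition Delta (R : realType) (eta1 : R) : R := Num.sqrt `|eta1 ^+ 2 - 4|.

Definition beta1 (R : realType) (eta1 : R) : R := Num.sqrt `|2 - eta1| / 2.

Definition beta2 (R : realType) (eta1 : R) : R := Num.sqrt `|2 + eta1| / 2.

(** Only used for [l = 1] (minus sign) and [l = 2] (plus sign). *)
Definition omega (R : realType) (eta1 : R) (l : nat) : R :=
  Num.sqrt (`|eta1 + (-1) ^+ l * Delta eta1| / 2).

(** Meaningful for [-2 < eta1], where the last branch is [2 < eta1]. *)
Definition V3 (R : realType) (eta1 x : R) : R :=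
  if `|eta1| < 2 then
    1 / (4 * beta1 eta1) *
      ln ((x ^+ 2 - 2 * beta1 eta1 * x + 1) / (x ^+ 2 + 2 * beta1 eta1 * x + 1))
    + 1 / (2 * beta2 eta1) *
      \sum_(l <- [:: 1; -1]) atan ((x + l * beta1 eta1) / beta2 eta1)
  else if eta1 == 2 then atan x - x / (1 + x ^+ 2)
  else 2 / Delta eta1 *
    \sum_(1 <= l < 3) (-1) ^+ l * omega eta1 l * atan (x / omega eta1 l).

(* Main.v *)
(* Writing V(r) = 4/3 pi r^3 for the volume of the ball, the integral of f(|k|)
   over the shell s < |k| <= t differs from f(r) (V(t) - V(s)) by at most
   (V(t) - V(s)) times the oscillation of f about f(r).  Hence F(r), the integral
   over the ball of radius r, has derivative f(r) V'(r) = 4 pi r^2 f(r), and it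
   equals any primitive of this function vanishing at 0.  For the spectral density,
   2 pi eta0 V3(eta1, r xi) is such a primitive, because V3(eta1, x) has derivative
   2 x^2 / (1 + eta1 x^2 + x^4) in each of the three regimes. *)
Require Import Defs.
From mathcomp Require Import all_boot all_order all_algebra.
From mathcomp Require Import complex.
From mathcomp Require Import ring lra.
From mathcomp Require Import all_classical all_reals all_analysis.
From mathcomp Require Import measurable_realfun.

Import Order.TTheory GRing.Theory Num.Theory.
Import numFieldNormedType.Exports.

Local Open Scope classical_set_scope.
Local Open Scope ring_scope.
Local Open Scope complex_scope.

(* The library states these rules for [f + g], [f * g] and so on, with which a
   lambda abstraction does not unify syntactically. *)
Section pointwise_derivatives.
Context {R : realType}.
Implicit Types (f g : R -> R) (x a b c : R).

Lemma is_derive_fctD {f g x a b} : is_derive x 1 f a -> is_derive x 1 g b ->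
  is_derive x 1 (fun y => f y + g y) (a + b).
Proof. exact: is_deriveD. Qed.

Lemma is_derive_fctN {f x a} : is_derive x 1 f a ->
  is_derive x 1 (fun y => - f y) (- a).
Proof. exact: is_deriveN. Qed.

Lemma is_derive_fctM {f g x a b} : is_derive x 1 f a -> is_derive x 1 g b ->
  is_derive x 1 (fun y => f y * g y) (f x * b + g x * a).
Proof. exact: is_deriveM. Qed.

Lemma is_derive_fctX {f n x a} : is_derive x 1 f a ->
  is_derive x 1 (fun y => f y ^+ n) (n%:R * f x ^+ n.-1 * a).
Proof.
move=> h; have := is_deriveX n h.
by rewrite (_ : f ^+ n = fun y => f y ^+ n) //; apply/funext => y; rewrite fctE.
Qed.

Lemma is_derive_fctV {f x a} : f x != 0 -> is_derive x 1 f a ->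
  is_derive x 1 (fun y => (f y)^-1) (- f x ^- 2 * a).
Proof. exact: is_deriveV. Qed.

Lemma is_derive_fctC c x : is_derive x 1 (fun=> c) 0.
Proof. exact: is_derive_cst. Qed.

Lemma is_derive_fct_atan {f x a} : is_derive x 1 f a ->
  is_derive x 1 (fun y => atan (f y)) ((1 + f x ^+ 2)^-1 * a).
Proof. by move=> h; exact: (is_derive1_comp (is_derive1_atan _) h). Qed.

Lemma is_derive_fct_ln {f x a} : 0 < f x -> is_derive x 1 f a ->
  is_derive x 1 (fun y => ln (f y)) ((f x)^-1 * a).
Proof. by move=> f0 h; exact: (is_derive1_comp (is_derive1_ln f0) h). Qed.

Lemma is_derive_fct_sqrt {f x a} : 0 < f x -> is_derive x 1 f a ->
  is_derive x 1 (fun y => Num.sqrt (f y)) ((2 * Num.sqrt (f x))^-1 * a).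
Proof. by move=> f0 h; exact: (is_derive1_comp (is_derive1_sqrt f0) h). Qed.

End pointwise_derivatives.

(* [notypeclasses] keeps the library instances from solving subgoals with
   derivatives in another form. *)
Ltac is_derive_step := first
  [ exact: is_derive_id | exact: is_derive_fctC
  | notypeclasses refine (is_derive_fctD _ _)
  | notypeclasses refine (is_derive_fctN _)
  | notypeclasses refine (is_derive_fctX _ _)
  | notypeclasses refine (is_derive_fctM _ _)
  | notypeclasses refine (is_derive_fct_atan _)
  | notypeclasses refine (is_derive_fctV _ _)
  | notypeclasses refine (is_derive_fct_ln _ _)
  | notypeclasses refine (is_derive_fct_sqrt _ _) ].

(** The derivative is built as a unification variable from the shape of the function; what remains
    is side conditions and its equality with the announced value. *)
Ltac is_derive_fct :=
  notypeclasses refine (is_derive_eq _ _); [do ! is_derive_step|].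

(** * Integration of radial functions by shells *)

(** Stands in for polar coordinates: the geometry of [N] enters only through the measure [V] of its
    sublevel sets. The function [F - H] has zero derivative between 0 and [c], so the mean value
    theorem equates its values at both ends. *)
Lemma Rintegral_sublevel (R : realType) d (T : measurableType d)
    (mu : {measure set T -> \bar R}) (N : T -> R) (V v f H : R -> R) (c : R) :
  measurable_fun setT N -> (forall x, 0 <= N x) ->
  (forall r, 0 <= r -> mu [set x | N x <= r] = (V r)%:E) -> V 0 = 0 ->
  (forall r : R, is_derive r 1 V (v r)) -> continuous f ->
  (forall r : R, is_derive r 1 H (f r * v r)) -> 0 < c ->
  \int[mu]_(x in [set x | N x <= c]) f (N x) = H c - H 0.
Proof.
move=> mN N_ge0 muV V0 dV cf dH c0.
pose B r := [set x | N x <= r].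
have mB r : measurable (B r).
  have := mN measurableT _ (measurable_itv `]-oo, r]).
  by rewrite setTI; congr measurable.
have mfN : measurable_fun setT (f \o N).
  by apply: measurableT_comp => //; exact: continuous_measurable_fun.
have bnd r : 0 <= r -> exists M : R, forall u, 0 <= u <= r -> `|f u| <= M.
  move=> r0; have [|m _ mP] := @EVT_max _ (fun u => `|f u|) 0 r r0.
    by apply: continuous_subspaceT => x; apply: cvg_norm; exact: cf.
  by exists `|f m| => u ur; apply: mP; rewrite in_itv.
have ifN r : 0 <= r -> mu.-integrable (B r) (EFin \o (f \o N)).
  move=> r0; apply: measurable_bounded_integrable => //.
  - by rewrite muV// ltry.
  - exact: measurable_funTS.
  - have [M Mf] := bnd _ r0; exists M; split; first exact: num_real.
    by move=> y My x /= Bx; rewrite (le_trans (Mf _ _) (ltW My))// N_ge0.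
pose F r := \int[mu]_(x in B r) f (N x).
(* The shell estimate, used with [a = f x] for the derivative of [F] and with [s = 0], [a = 0] for
   its right continuity at 0. *)
have key s t a e : 0 <= s -> s <= t ->
    (forall u, s <= u <= t -> `|f u - a| <= e) ->
    `|F t - F s - a * (V t - V s)| <= e * `|V t - V s|.
  move=> s0 st fe.
  have t0 : 0 <= t by exact: le_trans st.
  pose D := B t `\` B s.
  have mD : measurable D by exact: measurableD.
  have BtE : B t = B s `|` D.
    by apply/esym/setDUK => x /= /le_trans; exact.
  have dBD : [disjoint B s & D] by apply/disj_setPS; rewrite setDIK.
  have iD : mu.-integrable D (EFin \o (f \o N)).
    by apply: integrableS (ifN _ t0) => // x [].
  have muD : mu D = (V t - V s)%:E.
    have BtsE : B t `&` B s = B s.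
      apply/seteqP; split=> x /=; rewrite /B/=; last first.
        by move=> xs; split=> //; exact: le_trans st.
      by case.
    have muB r : 0 <= r -> mu (B r) = (V r)%:E by exact: muV.
    by rewrite measureD//= ?BtsE ?muB// ltry.
  have Vst : 0 <= V t - V s by rewrite -lee_fin -muD.
  have icst (r : R) : mu.-integrable D (EFin \o cst r).
    apply: measurable_bounded_integrable => //; first by rewrite muD ltry.
    by exists `|r|; split; [exact: num_real|move=> y ry z _; exact: ltW].
  have iB : mu.-integrable D (EFin \o (fun x => f (N x) - a)).
    by have := integrableB mD iD (icst a); apply: eq_integrable.
  (* [F t - F s] is the integral over the shell [D], and [a * (V t - V s)] is that of the constant
     [a]. *)
  rewrite [X in X - _ - _](_ : F t = F s + \int[mu]_(x in D) f (N x)); last first.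
    by rewrite /F BtE Rintegral_setU// -BtE; exact: ifN.
  rewrite [F s + _]addrC addrK.
  rewrite (_ : V t - V s = fine (mu D)); last by rewrite muD.
  rewrite -Rintegral_cst// -RintegralB//; last exact: icst.
  apply: (le_trans (le_normr_Rintegral _ _)) => //.
  rewrite muD ger0_norm// -[V t - V s]/(fine (V t - V s)%:E) -muD -Rintegral_cst//.
  apply: le_Rintegral => //; [|exact: icst|].
    by have := integrable_norm iB; apply: eq_integrable.
  move=> x [/= xt xs]; apply: fe; rewrite xt andbT.
  by rewrite ltW// ltNge; apply/negP.
have dF (x : R) : 0 < x -> is_derive x 1 F (f x * v x).
  move=> x0.
  pose q (G : R -> R) (h : R) : R := h^-1 *: ((G \o shift x) (h *: 1) - G x).
  suff qF : q F h @[h --> 0^'] --> f x * v x.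
    by split; [exact: cvgP qF|exact: cvg_lim].
  have qV : q V h @[h --> 0^'] --> v x by have [dVx <-] := dV x; exact: dVx.
  (* By the shell estimate [q F] is close to [f x * q V], whose limit is known. *)
  suff qFV : (q F h - f x * q V h) @[h --> 0^'] --> 0.
    rewrite -[f x * v x]add0r.
    rewrite (_ : q F = fun h => q F h - f x * q V h + f x * q V h); last first.
      by apply/funext => h; rewrite subrK.
    by apply: cvgD => //; apply: cvgM => //; exact: cvg_cst.
  apply/cvgr0Pnorm_lt => eps eps0.
  (* Adding 1 keeps the divisor positive when [v x = 0], and makes it a bound of [|q V h|] for small
     [h]. *)
  have v1 : 0 < `|v x| + 1 by rewrite ltr_wpDl.
  have dl0 : 0 < eps / (`|v x| + 1) by rewrite divr_gt0.
  have /cvgrPdist_le/(_ _ dl0)/nbhs_ballP[r /= r0 fr] := cf x.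
  near=> h.
  have hr : `|h| < r by near: h; apply: dnbhs0_lt.
  (* Keeps [h + x] positive: the shell estimate needs a nonnegative inner radius. *)
  have hx : `|h| < x by near: h; apply: dnbhs0_lt.
  have qh : `|q V h| < `|v x| + 1.
    by near: h; apply: (cvgr_norm_lt (v x) qV); rewrite ltrDl.
  have {qh} : eps / (`|v x| + 1) * `|q V h| < eps.
    by rewrite -[ltRHS](divfK (lt0r_neq0 v1)) ltr_pM2l.
  apply: le_lt_trans.
  rewrite /q/= /GRing.scale/= mulr1 mulrCA -mulrBr !normrM mulrCA.
  rewrite ler_wpM2l//.
  have fe u : `|u - x| <= `|h| -> `|f u - f x| <= eps / (`|v x| + 1).
    move=> ux; rewrite distrC; apply: fr; rewrite /ball/= distrC.
    exact: le_lt_trans hr.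
  have [h_ge0|h_lt0] := leP 0 h.
    apply: key; [exact: ltW|by rewrite lerDr|].
    move=> u /andP[xu uh]; apply: fe; rewrite !ger0_norm ?subr_ge0//.
    by rewrite lerBlDr.
  (* For negative [h] the shell runs from [h + x] to [x], and both differences change sign. *)
  move: hx; rewrite (ltr0_norm h_lt0) => hx.
  rewrite (_ : _ - _ - _ = - (F x - F (h + x) - f x * (V x - V (h + x)))).
    rewrite normrN [X in _ <= _ * X]distrC; apply: key; [lra|lra|].
    by move=> u /andP[hu ux]; apply: fe; rewrite (ltr0_norm h_lt0) ler0_norm; lra.
  by ring.
have cF (x : R) : 0 < x -> {for x, continuous F}.
  move=> /dF dFx; apply/differentiable_continuous/derivable1_diffP.
  exact: ex_derive.
have F0 : F 0 = 0.
  rewrite /F /Rintegral null_set_integral ?fine0//; last by rewrite muV// V0.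
  by apply: measurable_funTS; apply/measurable_EFinP.
have cH x : {for x, continuous H}.
  by apply/differentiable_continuous/derivable1_diffP; exact: ex_derive.
have cV x : {for x, continuous V}.
  by apply/differentiable_continuous/derivable1_diffP; exact: ex_derive.
have [||y _] := @MVT _ (fun x => F x - H x) (fun=> 0) 0 c c0.
- move=> x; rewrite in_itv/= => /andP[x0 _].
  apply: (is_derive_eq (is_derive_fctD (dF _ x0) (is_derive_fctN (dH x)))).
  by rewrite subrr.
- apply/continuous_within_itvP => //; split.
  + move=> x; rewrite in_itv/= => /andP[x0 _].
    by apply: cvgB; [exact: cF|exact: cH].
  (* [muV] covers nonnegative radii only, so continuity at 0 is one-sided: [|F x| <= M * |V x|],
     which tends to 0 because [V 0 = 0]. *)
  + apply: cvgB; last by apply: cvg_at_right_filter; exact: cH.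
    have [M Mf] := bnd _ (ltW c0).
    have VM : M * `|V x| @[x --> 0^'+] --> 0.
      rewrite [X in _ --> X](_ : 0 = M * `|V 0|); last by rewrite V0 normr0 mulr0.
      apply: cvg_at_right_filter; apply: cvgM; first exact: cvg_cst.
      by apply: cvg_norm; exact: cV.
    have VMN : - (M * `|V x|) @[x --> 0^'+] --> 0.
      by rewrite -[X in _ --> X]oppr0; exact: cvgN.
    rewrite F0; apply: squeeze_cvgr VMN VM.
    near=> x; rewrite -ler_norml.
    have := key 0 x 0 M (lexx _) _ _.
    rewrite F0 V0 !subr0 mul0r subr0; apply.
      by near: x; exact: nbhs_right_ge.
    move=> u /andP[u0 ux]; rewrite subr0; apply: Mf; rewrite u0/=.
    by rewrite (le_trans ux)//; near: x; exact: nbhs_right_le.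
  + apply: cvg_at_left_filter; apply: cvgB; [exact: cF|exact: cH].
by rewrite mul0r F0 /F => /eqP; rewrite subr_eq0 => /eqP h; lra.
Unshelve. all: by end_near.
Qed.

(** * Volume of the Euclidean ball *)

(** The area of a disc by its chord lengths, from the classical primitive
    [x * s x + r ^+ 2 * arcsin (x / r)]. *)
Lemma integral_sqrt (R : realType) (r : R) : 0 < r ->
  (\int[@lebesgue_measure R]_(x in `[(- r)%R, r]) (2 * Num.sqrt (r ^+ 2 - x ^+ 2))%:E
   = (pi * r ^+ 2)%:E)%E.
Proof.
move=> r0.
pose s (x : R) := Num.sqrt (r ^+ 2 - x ^+ 2).
have s_ge0 x : 0 <= s x by exact: sqrtr_ge0.
(* The arcsine of [x / r], written as [2 * atan (x / (r + s x))] to be continuous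
   up to the end points. *)
pose F (x : R) : R := x * s x + 2 * r ^+ 2 * atan (x / (r + s x)).
have rs x : r + s x != 0 by apply: lt0r_neq0; have := s_ge0 x; lra.
have cs : continuous s.
  move=> x; apply: continuous_cvg; first exact: sqrt_continuous.
  by apply: cvgB; [exact: cvg_cst|exact: exprn_continuous].
have cF : continuous F.
  move=> x; apply: cvgD; first by apply: cvgM; [exact: cvg_id|exact: cs].
  apply: cvgM; first exact: cvg_cst.
  apply: continuous_cvg; first exact: continuous_atan.
  apply: cvgM; first exact: cvg_id.
  apply: cvgV => //; apply: cvgD; [exact: cvg_cst|exact: cs].
have dF x : x \in `](- r), r[ -> is_derive x 1 F (2 * s x).
  rewrite in_itv/= => /andP[x1 x2].
  have p0 : 0 < r ^+ 2 - x ^+ 2 by nra.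
  have s0 : 0 < s x by rewrite sqrtr_gt0.
  have sE : s x ^+ 2 = r ^+ 2 - x ^+ 2 by rewrite sqr_sqrtr// ltW.
  rewrite /F /s; is_derive_fct => //; first exact: rs.
  rewrite /= -/(s x).
  have -> : (1 + (x / (r + s x)) ^+ 2)^-1 = (r + s x) / (2 * r).
    have -> : 1 + (x / (r + s x)) ^+ 2 = ((r + s x) ^+ 2 + x ^+ 2) / (r + s x) ^+ 2.
      by field.
    have -> : (r + s x) ^+ 2 + x ^+ 2 = 2 * r * (r + s x).
      by rewrite sqrrD sE; ring.
    by field; rewrite rs; lra.
  have xE : x ^+ 2 = r ^+ 2 - s x ^+ 2 by rewrite sE; ring.
  (* [field] does not know how [s x] depends on [x], so the difference of the two sides is first
     reduced to a multiple of [r ^+ 2 - s x ^+ 2 - x ^+ 2]. *)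
  apply/eqP; rewrite -subr_eq0; apply/eqP.
  rewrite [LHS](_ : _ = (r ^+ 2 - s x ^+ 2 - x ^+ 2) / (r + s x)).
    by rewrite xE; ring.
  by field; rewrite rs; lra.
(* [s] is not differentiable at [- r] and [r]; derivatives inside the interval and continuity of [F]
   at its ends suffice. *)
rewrite (@continuous_FTC2 _ (fun x => 2 * s x) F).
- rewrite /F /s sqrrN subrr sqrtr0 addr0 !mulNr divff ?gt_eqF// atanN atan1.
  by rewrite -EFinB; congr EFin; field.
- lra.
- apply: continuous_subspaceT => x; apply: cvgM; [exact: cvg_cst|exact: cs].
- split.
  + by move=> x /dF d; exact: ex_derive.
  + by apply: cvg_at_right_filter; exact: cF.
  + by apply: cvg_at_left_filter; exact: cF.
- by move=> x /dF d; rewrite derive1E derive_val.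
Qed.

(** The length of a chord. Since [Num.sqrt] is 0 on negative numbers, the formula also covers empty
    sections. *)
Lemma lebesgue_measure_sqr_le (R : realType) (a : R) :
  lebesgue_measure [set x : R | x ^+ 2 <= a] = (2 * Num.sqrt a)%:E.
Proof.
have [a0|a0] := ltP a 0.
  rewrite (_ : [set _ | _] = set0) ?measure0.
    by rewrite ler0_sqrtr ?mulr0// ltW.
  by apply/seteqP; split=> // x/=; have := sqr_ge0 x; lra.
rewrite (_ : [set _ | _] = `[- Num.sqrt a, Num.sqrt a]%classic).
  rewrite lebesgue_measure_itv/= lte_fin.
  have := sqrtr_ge0 a; rewrite le_eqVlt => /predU1P[<-|s0].
    by rewrite mulr0 oppr0 ltxx.
  by rewrite ifT -?EFinB; [congr EFin; ring|lra].
apply/seteqP; split=> x /=; rewrite in_itv/= -ler_norml -sqrtr_sqr.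
  by move=> ?; rewrite ler_sqrt.
by rewrite ler_sqrt.
Qed.

(** Truncation by [Num.sqrt] and [Num.max] replaces a domain depending on the outer variable, so
    that Tonelli's theorem can be used on the whole plane. *)
Lemma integral_sqrtT (R : realType) (a : R) :
  (\int[@lebesgue_measure R]_x (2 * Num.sqrt (a - x ^+ 2))%:E
   = (pi * Num.max a 0)%:E)%E.
Proof.
have [a0|a0] := leP a 0.
  rewrite mulr0 integral0_eq// => x _; rewrite ler0_sqrtr ?mulr0//.
  by have := sqr_ge0 x; lra.
have sa : a = Num.sqrt a ^+ 2 by rewrite sqr_sqrtr// ltW.
rewrite [in RHS]sa -integral_sqrt ?sqrtr_gt0//.
rewrite [RHS]integral_mkcond; apply: eq_integral => x _.
rewrite patchE; case: ifPn => [_|]; first by rewrite -sa.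
rewrite notin_setE/= in_itv/= -ler_norml => /negP; rewrite -ltNge => xa.
rewrite ler0_sqrtr ?mulr0// subr_le0 sa -[leRHS]real_normK ?num_real//.
by rewrite lerXn2r ?nnegrE ?sqrtr_ge0// ltW.
Qed.

Lemma measurable_norm3 (R : realType) : measurable_fun setT (@norm3 R).
Proof.
apply: measurableT_comp.
  by apply: continuous_measurable_fun; exact: sqrt_continuous.
have m1 : measurable_fun setT (fun k : R * R * R => k.1.1).
  exact: measurableT_comp measurable_fst measurable_fst.
have m2 : measurable_fun setT (fun k : R * R * R => k.1.2).
  exact: measurableT_comp measurable_snd measurable_fst.
have m3 : measurable_fun setT (fun k : R * R * R => k.2).
  exact: measurable_snd.
by apply: measurable_funD; [apply: measurable_funD|]; exact: measurable_funM.
Qed.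

Lemma norm3_ge0 (R : realType) (k : R * R * R) : 0 <= norm3 k.
Proof. exact: sqrtr_ge0. Qed.

Lemma measurable_ball3 (R : realType) (r : R) :
  measurable [set k : R * R * R | norm3 k <= r].
Proof.
have := @measurable_norm3 R measurableT _ (measurable_itv `]-oo, r]).
by rewrite setTI; congr measurable.
Qed.

(** Slicing: the chords in the third coordinate, integrated over the second, give areas of discs,
    which are then integrated over the first. *)
Lemma lebesgue3_ball (R : realType) (r : R) : 0 <= r ->
  lebesgue3 [set k : R * R * R | norm3 k <= r] = (4 / 3 * pi * r ^+ 3)%:E.
Proof.
move=> r_ge0.
transitivity (\int[@lebesgue_measure R]_x
    (pi * Num.max (r ^+ 2 - x ^+ 2) 0)%:E)%E.
  rewrite /lebesgue3 {1}/product_measure1/=.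
  have sec p : xsection [set k : R * R * R | norm3 k <= r] p
     = [set z | z ^+ 2 <= r ^+ 2 - p.1 ^+ 2 - p.2 ^+ 2].
    apply/seteqP; split=> z/=; rewrite /xsection/= inE/= /norm3 /dot3/= -!expr2.
      move=> h; rewrite -addrA -opprD lerBrDl.
      by rewrite -(@ler_sqrt _ _ (r ^+ 2)) ?sqr_ge0// sqrtr_sqr ger0_norm.
    rewrite -addrA -opprD lerBrDl => h.
    by rewrite -[leRHS]ger0_norm// -sqrtr_sqr ler_sqrt ?sqr_ge0.
  under eq_integral do rewrite sec lebesgue_measure_sqr_le.
  rewrite fubini_tonelli1/=.
  - by apply: eq_integral => x _; rewrite /fubini_F/= integral_sqrtT.
  - apply/measurable_EFinP; apply: measurable_funM; first exact: measurable_cst.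
    apply: measurableT_comp.
      by apply: continuous_measurable_fun; exact: sqrt_continuous.
    apply: measurable_funB; [apply: measurable_funB => //|];
      apply: measurable_funX; [exact: measurable_fst|exact: measurable_snd].
  - by move=> p; rewrite lee_fin mulr_ge0// sqrtr_ge0.
(* The fundamental theorem below needs [- r < r], hence the separate case [r = 0]. *)
move: r_ge0; rewrite le_eqVlt => /predU1P[<-|r0].
  rewrite !expr0n/= mulr0 integral0_eq// => x _; rewrite (_ : Num.max _ _ = 0) ?mulr0//.
  by apply/max_idPr; have := sqr_ge0 x; lra.
pose F (x : R) : R := pi * (r ^+ 2 * x - x ^+ 3 / 3).
have dF (x : R) : is_derive x 1 F (pi * (r ^+ 2 - x ^+ 2)).
  by rewrite /F; is_derive_fct => /=; field.
have dF' (x : R) : derivable F x 1 by exact: ex_derive.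
have cF : continuous F.
  by move=> x; apply/differentiable_continuous/derivable1_diffP/dF'.
transitivity (\int[@lebesgue_measure R]_(x in `[(- r)%R, r])
    (pi * (r ^+ 2 - x ^+ 2))%:E)%E.
  rewrite [RHS]integral_mkcond; apply: eq_integral => x _.
  rewrite patchE; case: ifPn => [|].
    rewrite inE/= in_itv/= => /andP[x1 x2].
    by rewrite (_ : Num.max _ _ = r ^+ 2 - x ^+ 2)//; apply/max_idPl; nra.
  rewrite notin_setE/= in_itv/= -ler_norml => /negP; rewrite -ltNge => xr.
  rewrite (_ : Num.max _ _ = 0) ?mulr0//; apply/max_idPr.
  by rewrite subr_le0 -[leRHS]real_normK ?num_real// lerXn2r ?nnegrE// ltW.
rewrite (@continuous_FTC2 _ (fun x => pi * (r ^+ 2 - x ^+ 2)) F).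
- by rewrite -EFinB; congr EFin; rewrite /F; field.
- lra.
- apply: continuous_subspaceT => x; apply: cvgM; first exact: cvg_cst.
  by apply: cvgB; [exact: cvg_cst|exact: exprn_continuous].
- split.
  + by [].
  + by apply: cvg_at_right_filter; exact: cF.
  + by apply: cvg_at_left_filter; exact: cF.
- by move=> x _; rewrite derive1E derive_val.
Qed.

(** * Derivative of [V3] in the three regimes *)

(** The quartic equals [(1 - x ^+ 2) ^+ 2 + (eta1 + 2) * x ^+ 2]. *)
Lemma quartic_gt0 (R : realType) (eta1 x : R) :
  -2 < eta1 -> 0 < 1 + eta1 * x ^+ 2 + x ^+ 4.
Proof.
move=> h; have [->|x0] := eqVneq x 0; first by rewrite !expr0n/=; lra.
have h2 : 0 < eta1 + 2 by lra.
have x2 : 0 < x ^+ 2 by rewrite exprn_even_gt0.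
by have := mulr_gt0 h2 x2; have := sqr_ge0 (1 - x ^+ 2); nra.
Qed.

(** Partial fractions: the quartic is the product of [x ^+ 2 - 2 * b1 * x + 1] and
    [x ^+ 2 + 2 * b1 * x + 1], which are [(x - b1) ^+ 2 + b2 ^+ 2] and [(x + b1) ^+ 2 + b2 ^+ 2]. *)
Lemma is_derive_V3_lt (R : realType) (b1 b2 x : R) : 0 < b1 -> 0 < b2 ->
  b1 ^+ 2 + b2 ^+ 2 = 1 ->
  is_derive x 1 (fun y => 1 / (4 * b1) *
      ln ((y ^+ 2 - 2 * b1 * y + 1) / (y ^+ 2 + 2 * b1 * y + 1))
    + 1 / (2 * b2) * (atan ((y + 1 * b1) / b2) + atan ((y + -1 * b1) / b2)))
    (2 * x ^+ 2 / (1 + (2 - 4 * b1 ^+ 2) * x ^+ 2 + x ^+ 4)).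
Proof.
move=> b10 b20 b12.
have q1 : 0 < x ^+ 2 - 2 * b1 * x + 1.
  have := sqr_ge0 (x - b1); have : 0 < b2 ^+ 2 by rewrite exprn_gt0.
  nra.
have q2 : 0 < x ^+ 2 + 2 * b1 * x + 1.
  have := sqr_ge0 (x + b1); have : 0 < b2 ^+ 2 by rewrite exprn_gt0.
  nra.
have q3 : 0 < 1 + (2 - 4 * b1 ^+ 2) * x ^+ 2 + x ^+ 4.
  by have := mulr_gt0 q1 q2; congr (_ < _); ring.
have q4 : 1 + ((x + 1 * b1) / b2) ^+ 2 = (x ^+ 2 + 2 * b1 * x + 1) / b2 ^+ 2.
  rewrite (_ : x ^+ 2 + 2 * b1 * x + 1 = (x + b1) ^+ 2 + b2 ^+ 2).
    by field; lra.
  by rewrite -[X in _ + X = _]b12; ring.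
have q5 : 1 + ((x - 1 * b1) / b2) ^+ 2 = (x ^+ 2 - 2 * b1 * x + 1) / b2 ^+ 2.
  rewrite (_ : x ^+ 2 - 2 * b1 * x + 1 = (x - b1) ^+ 2 + b2 ^+ 2).
    by field; lra.
  by rewrite -[X in _ + X = _]b12; ring.
is_derive_fct; [by rewrite divr_gt0|lra|].
rewrite mulN1r -[X in x - X]mul1r q4 q5 /=; field.
by repeat (apply/andP; split); lra.
Qed.

(** Here the quartic is the square of [1 + x ^+ 2]. *)
Lemma is_derive_V3_eq (R : realType) (x : R) :
  is_derive x 1 (fun y => atan y - y / (1 + y ^+ 2))
    (2 * x ^+ 2 / (1 + 2 * x ^+ 2 + x ^+ 4)).
Proof.
have q1 : 0 < 1 + x ^+ 2 by have := sqr_ge0 x; lra.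
have q3 : 0 < 1 + 2 * x ^+ 2 + x ^+ 4.
  by have := mulr_gt0 q1 q1; congr (_ < _); ring.
is_derive_fct; [lra|rewrite /=]; field.
repeat (apply/andP; split); lra.
Qed.

(** Partial fractions: [x ^+ 2 * (b ^+ 2 - a ^+ 2)] equals [b ^+ 2 * (x ^+ 2 + a ^+ 2) - a ^+ 2 * (x
    ^+ 2 + b ^+ 2)]. *)
Lemma is_derive_V3_gt (R : realType) (a b x : R) : 0 < a -> a < b ->
  is_derive x 1 (fun y => 2 / (b ^+ 2 - a ^+ 2) *
    (- (a * atan (y / a)) + b * atan (y / b)))
    (2 * x ^+ 2 / ((x ^+ 2 + a ^+ 2) * (x ^+ 2 + b ^+ 2))).
Proof.
move=> a0 ab; have b0 : 0 < b by lra.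
have q0 : 0 < b ^+ 2 - a ^+ 2 by nra.
have q1 : 0 < x ^+ 2 + a ^+ 2 by have := sqr_ge0 x; nra.
have q2 : 0 < x ^+ 2 + b ^+ 2 by have := sqr_ge0 x; nra.
have q4 : 1 + (x / a) ^+ 2 = (x ^+ 2 + a ^+ 2) / a ^+ 2 by field; lra.
have q5 : 1 + (x / b) ^+ 2 = (x ^+ 2 + b ^+ 2) / b ^+ 2 by field; lra.
is_derive_fct; rewrite q4 q5 /=; field.
repeat (apply/andP; split); lra.
Qed.

Lemma sumr_pm1 (R : realType) (F : R -> R) :
  \sum_(l <- [:: 1; -1]) F l = F 1 + F (-1).
Proof. by rewrite !big_cons big_nil addr0. Qed.

Lemma is_derive_V3 (R : realType) (eta1 x : R) : -2 < eta1 ->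
  is_derive x 1 (V3 eta1) (2 * x ^+ 2 / (1 + eta1 * x ^+ 2 + x ^+ 4)).
Proof.
move=> eta1_gtN2.
have [eta1_lt2|] := ltP `|eta1| 2.
  move: (eta1_lt2); rewrite ltr_norml => /andP[_ eta1_lt2'].
  have p1 : 0 < 2 - eta1 by rewrite subr_gt0.
  have p2 : 0 < 2 + eta1 by lra.
  have b1 : 0 < beta1 eta1 by rewrite divr_gt0// sqrtr_gt0 normr_gt0 gt_eqF.
  have b2 : 0 < beta2 eta1 by rewrite divr_gt0// sqrtr_gt0 normr_gt0 gt_eqF.
  have b1E : beta1 eta1 ^+ 2 = (2 - eta1) / 4.
    by rewrite expr_div_n sqr_sqrtr ?normr_ge0// gtr0_norm//; field.
  have b2E : beta2 eta1 ^+ 2 = (2 + eta1) / 4.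
    by rewrite expr_div_n sqr_sqrtr ?normr_ge0// gtr0_norm//; field.
  have := @is_derive_V3_lt _ _ _ x b1 b2 _.
  rewrite (_ : 2 - 4 * beta1 eta1 ^+ 2 = eta1); last by rewrite b1E; field.
  rewrite (_ : V3 eta1 = fun y => 1 / (4 * beta1 eta1) *
      ln ((y ^+ 2 - 2 * beta1 eta1 * y + 1) / (y ^+ 2 + 2 * beta1 eta1 * y + 1))
    + 1 / (2 * beta2 eta1) * (atan ((y + 1 * beta1 eta1) / beta2 eta1)
      + atan ((y + -1 * beta1 eta1) / beta2 eta1))).
    by apply; rewrite b1E b2E; field.
  by apply/funext => y; rewrite /V3 eta1_lt2 sumr_pm1.
rewrite leNgt => eta1N.
have [eta1_eq2|eta1_neq2] := eqVneq eta1 2.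
  rewrite {}eta1_eq2 in eta1N *; rewrite (_ : V3 2 = fun y => atan y - y / (1 + y ^+ 2)).
    exact: is_derive_V3_eq.
  by apply/funext => y; rewrite /V3 (negbTE eta1N) eqxx.
have eta1_gt2 : 2 < eta1.
  rewrite lt_neqAle eq_sym eta1_neq2/= leNgt; apply: contra eta1N => h.
  by rewrite ltr_norml eta1_gtN2.
have D2 : Delta eta1 ^+ 2 = eta1 ^+ 2 - 4.
  by rewrite sqr_sqrtr ?normr_ge0// ger0_norm//; nra.
have D0 : 0 < Delta eta1 by rewrite sqrtr_gt0 normr_gt0 gt_eqF//; nra.
(* Lets the absolute value in [omega eta1 1] be dropped and makes this divisor positive. *)
have De : Delta eta1 < eta1 by nra.
have aE : omega eta1 1 ^+ 2 = (eta1 - Delta eta1) / 2.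
  by rewrite sqr_sqrtr ?divr_ge0// expr1 mulN1r gtr0_norm// subr_gt0.
have bE : omega eta1 2 ^+ 2 = (eta1 + Delta eta1) / 2.
  by rewrite sqr_sqrtr ?divr_ge0// sqrrN expr1n mul1r gtr0_norm//; lra.
have a0 : 0 < omega eta1 1.
  by rewrite sqrtr_gt0 divr_gt0// normr_gt0 expr1 mulN1r gt_eqF// subr_gt0.
have b0 : 0 <= omega eta1 2 by exact: sqrtr_ge0.
have ab : omega eta1 1 < omega eta1 2.
  by rewrite -(@ltr_pXn2r _ 2)// ?nnegrE ?ltW// aE bE; lra.
have := is_derive_V3_gt _ _ _ x a0 ab.
have -> : omega eta1 2 ^+ 2 - omega eta1 1 ^+ 2 = Delta eta1.
  by rewrite aE bE; field.
(* Vieta: the squares of the two [omega] have sum [eta1] and product 1. *)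
have -> : (x ^+ 2 + omega eta1 1 ^+ 2) * (x ^+ 2 + omega eta1 2 ^+ 2)
    = 1 + eta1 * x ^+ 2 + x ^+ 4.
  have ab1 : omega eta1 1 ^+ 2 * omega eta1 2 ^+ 2 = 1.
    rewrite aE bE; transitivity ((eta1 ^+ 2 - Delta eta1 ^+ 2) / 4); first by field.
    by rewrite D2; field.
  transitivity (omega eta1 1 ^+ 2 * omega eta1 2 ^+ 2
    + (omega eta1 1 ^+ 2 + omega eta1 2 ^+ 2) * x ^+ 2 + x ^+ 4); first by ring.
  by rewrite ab1 aE bE; field.
rewrite (_ : V3 eta1 = fun y => 2 / Delta eta1 *
   (- (omega eta1 1 * atan (y / omega eta1 1))
     + omega eta1 2 * atan (y / omega eta1 2)))//.
apply/funext => y; rewrite /V3 (negbTE eta1N) (negbTE eta1_neq2).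
by rewrite big_nat_recr//= big_nat1 expr1 mulN1r sqrrN expr1n mul1r mulNr.
Qed.

Lemma V3_0 (R : realType) (eta1 : R) : V3 eta1 0 = 0.
Proof.
rewrite /V3; case: ifPn => _.
  rewrite sumr_pm1 !mulr0 expr0n/= subr0 addr0 !add0r divr1 ln1 mulr0.
  by rewrite add0r !mul1r mulN1r mulNr atanN subrr mulr0.
case: ifPn => _; first by rewrite atan0 mul0r subrr.
by rewrite big_nat_recr//= big_nat1 !mul0r atan0 !mulr0 addr0 mulr0.
Qed.

(** * The covariance at lag 0 and the variance *)

(** At lag 0 the exponential is 1, which leaves the real integral of a radial function over the
    ball. *)
Lemma fgc_covariance0 (R : realType) (eta0 eta1 xi kc : R) :
  0 < kc -> 0 < xi -> -2 < eta1 ->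
  fgc_covariance eta0 eta1 xi kc 0
    = (eta0 / (4 * pi ^+ 2) * V3 eta1 (kc * xi))%:C.
Proof.
move=> kc0 xi0 eta1_gtN2.
rewrite /fgc_covariance /cintegral.
have dot0 (k : R * R * R) : dot3 k 0 = 0 by rewrite /dot3/= !mulr0 !addr0.
have Re0 (k : R * R * R) : complex.Re (expi (dot3 k 0) *
    (fgc_spectral_density eta0 eta1 xi (norm3 k))%:C)
    = fgc_spectral_density eta0 eta1 xi (norm3 k).
  by rewrite dot0 /expi cos0 sin0/= mul1r mul0r subr0.
have Im0 (k : R * R * R) : complex.Im (expi (dot3 k 0) *
    (fgc_spectral_density eta0 eta1 xi (norm3 k))%:C) = 0.
  by rewrite dot0 /expi cos0 sin0/= mulr0 mul0r addr0.
under eq_Rintegral do rewrite Re0.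
under [X in _ +i* X]eq_Rintegral do rewrite Im0.
rewrite Rintegral_cst; last exact: measurable_ball3.
rewrite mul0r.
(* The factor [2 * pi] is the [4 * pi] of the sphere area over the 2 in the derivative of [V3];
   divided by [(2 * pi) ^+ 3] it becomes [1 / (4 * pi ^+ 2)]. *)
pose H (k : R) := 2 * pi * eta0 * V3 eta1 (k * xi).
have -> : \int[@lebesgue3 R]_(k in [set k | norm3 k <= kc])
    fgc_spectral_density eta0 eta1 xi (norm3 k) = H kc - H 0; last first.
  rewrite /H mul0r V3_0 mulr0 subr0 -[X in _ * X]/(_%:C) -rmorphM/=.
  have pi0 : pi != 0 :> R by rewrite gt_eqF// pi_gt0.
  by move: (pi : R) pi0 => p p0; congr (_ +i* _); field.
apply: (@Rintegral_sublevel _ _ _ (@lebesgue3 R) (@norm3 R)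
  (fun r => 4 / 3 * pi * r ^+ 3) (fun r => 4 * pi * r ^+ 2)
  (fgc_spectral_density eta0 eta1 xi) H).
- exact: measurable_norm3.
- exact: norm3_ge0.
- exact: lebesgue3_ball.
- by rewrite expr0n mulr0.
- by move=> r; is_derive_fct => /=; field.
- move=> r; have q0 := @quartic_gt0 _ _ (r * xi) eta1_gtN2.
  (* Continuity only needs some derivative to exist, so its value is left to unification. *)
  have [df ?] : exists df : R,
      is_derive r 1 (fgc_spectral_density eta0 eta1 xi) df.
    by eexists; do ! is_derive_step; exact: lt0r_neq0.
  by apply/differentiable_continuous/derivable1_diffP; exact: ex_derive.
- move=> r; have q0 := @quartic_gt0 _ _ (r * xi) eta1_gtN2.
  have dxi : is_derive r 1 (fun k : R => k * xi) xi by is_derive_fct => /=; ring.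
  have dV := @is_derive1_comp _ (V3 eta1) (fun k => k * xi) r _ _
    (is_derive_V3 _ _ (r * xi) eta1_gtN2) dxi.
  apply: (is_derive_eq (is_derive_fctM (is_derive_fctC _ _) dV)).
  rewrite /fgc_spectral_density/=; field; exact: lt0r_neq0.
- exact: kc0.
Qed.

Theorem proposition3 (R : realType) (eta0 eta1 xi kc : R)
    (eta0_gt0 : 0 < eta0) (xi_gt0 : 0 < xi) (kc_gt0 : 0 < kc)
    (eta1_gtN2 : -2 < eta1) :
  fgc_covariance eta0 eta1 xi kc 0
    = (eta0 / (4 * pi ^+ 2) * V3 eta1 (kc * xi))%:C
  /\
  (forall (d : measure_display) (T : measurableType d) (P : probability T R)
      (X : R * R * R -> {RV P >-> R}),
     is_fgc_ssrf eta0 eta1 xi kc X ->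
     forall s : R * R * R,
       'V_P[X s]%E = (eta0 / (4 * pi ^+ 2) * V3 eta1 (kc * xi))%:E).
Proof.
have G0 := @fgc_covariance0 _ eta0 _ _ _ kc_gt0 xi_gt0 eta1_gtN2.
split=> // d T P X fgcX s.
have [c] := fgc_has_covariance fgcX s s.
(* The variance is the covariance at lag [s - s = 0]; injectivity of the embedding into [R[i]]
   identifies [c]. *)
by rewrite subrr G0 /variance => -> [->].
Qed.
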